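(* Let $p$ be a prime and $M\in\operatorname{SL}(n,\mathbb{Q}_p)$, and let $M=NAK$ be any Iwasawa decomposition of $M$, with $$A=\operatorname{diag}\Big(y_1,\tfrac{y_2}{y_1},\dots,\tfrac{y_{n-1}}{y_{n-2}},\tfrac{1}{y_{n-1}}\Big).$$ Then for every $k\in\{1,\dots,n-1\}$, $$|y_{n-k}|_p=\Big(\max_{\sigma\in\Theta_k^n}\Big|M\big(\begin{smallmatrix} n-k+1&\dots&n\\ \sigma(1)&\dots&\sigma(k)\end{smallmatrix}\big)\Big|_p\Big)^{-1},$$ where $\Theta_k^n$ is the set of all ordered subsets $\sigma=(\sigma(1)<\dots<\sigma(k))$ of $\{1,\dots,n\}$ of size $k$. In other words, $|y_{n-k}|_p$ is the inverse of the largest $p$-adic norm of an order-$k$ minor of $M$ built from the last $k$ rows of $M$.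
   Context: $|\cdot|_p$ is the $p$-adic norm and $\mathbb{Z}_p=\{x\in\mathbb{Q}_p:|x|_p\le1\}$. An Iwasawa decomposition of $M\in\operatorname{SL}(n,\mathbb{Q}_p)$ is a factorization $M=NAK$ with $N\in\operatorname{SL}(n,\mathbb{Q}_p)$ unit upper triangular (upper triangular with ones on the diagonal), $A\in\operatorname{SL}(n,\mathbb{Q}_p)$ diagonal, and $K\in\operatorname{SL}(n,\mathbb{Z}_p)$. For a matrix $M$, the minor $M\big(\begin{smallmatrix} r_1&\dots&r_k\\ c_1&\dots&c_k\end{smallmatrix}\big)$ is the determinant of $(M_{r_i c_j})_{i,j=1}^k$. *)

(* Defs.v *)
From HB Require Import structures.
From mathcomp Require Import all_boot all_order all_algebra.
From mathcomp Require Import generic_quotient ring_quotient.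
From mathcomp Require Import boolp classical_sets functions.

Set Implicit Arguments.
Unset Strict Implicit.
Unset Printing Implicit Defensive.

Import Order.TTheory GRing.Theory Num.Theory.
Local Open Scope ring_scope.
Local Open Scope quotient_scope.

(* For p not prime, logn p is constantly 0 and this is the trivial absolute
   value; hence the construction of padic p below does not need p to be prime. *)
Definition rat_padic_norm (p : nat) (x : rat) : rat :=
  if x == 0 then 0
  else p%:R ^ ((logn p `|denq x|%N)%:Z - (logn p `|numq x|%N)%:Z).

Section RatPadicNorm.
Variable p : nat.
Local Notation nrm := (rat_padic_norm p).
Implicit Types (x y : rat) (a b : int).

Lemma logn_absD_ge a b : a + b != 0 -> a != 0 -> b != 0 ->
  (minn (logn p `|a|%N) (logn p `|b|%N) <= logn p `|(a + b)%R|%N)%N.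
Proof.
move=> ab0 a0 b0; have [pp|npp] := boolP (prime p); last first.
  by rewrite /logn (negPf npp).
rewrite -pfactor_dvdn // ?absz_gt0 //.
suff : ((p ^ minn (logn p `|a|%N) (logn p `|b|%N))%N %| (a + b)%R)%Z by [].
by apply: rpredD; rewrite /in_mem/= /dvdz /= pfactor_dvdn
  ?absz_gt0 ?geq_minl ?geq_minr.
Qed.

Lemma rat_padic_norm0 : nrm 0 = 0. Proof. by rewrite /nrm eqxx. Qed.

Lemma rat_padic_norm_frac a b : a != 0 -> b != 0 ->
  nrm (a%:~R / b%:~R) = p%:R ^ ((logn p `|b|%N)%:Z - (logn p `|a|%N)%:Z).
Proof.
move=> a0 b0; rewrite /rat_padic_norm.
have x0 : a%:~R / b%:~R != 0 :> rat.
  by rewrite mulf_neq0 ?invr_eq0 ?intr_eq0.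
rewrite (negPf x0); congr (_ ^ _); set x := _ / _ in x0 *.
have : numq x * b = a * denq x.
  apply: (@intr_inj rat); rewrite !intrM [(numq x)%:~R]numqE /x mulrAC.
  by rewrite divfK ?intr_eq0.
move/(congr1 (fun z => logn p `|z|%N)); rewrite !abszM.
rewrite !lognM ?absz_gt0 ?denq_neq0 ?numq_eq0 // => /(congr1 Posz).
rewrite !PoszD => E.
by apply/eqP; rewrite subr_eq addrAC eq_sym subr_eq addrC E addrC.
Qed.

Lemma rat_padic_normE x : x != 0 ->
  nrm x = p%:R ^ ((logn p `|denq x|%N)%:Z - (logn p `|numq x|%N)%:Z).
Proof. by rewrite /rat_padic_norm => /negPf ->. Qed.

Lemma nonprime_norm x : ~~ prime p -> x != 0 -> nrm x = 1.
Proof. by move=> npp x0; rewrite rat_padic_normE // /logn (negPf npp). Qed.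

Lemma rat_padic_norm_gt0 x : (0 < nrm x) = (x != 0).
Proof.
have [->|x0] := eqVneq x 0; first by rewrite rat_padic_norm0 ltxx.
have [pp|npp] := boolP (prime p); last by rewrite nonprime_norm.
by rewrite rat_padic_normE // exprz_gt0 // ltr0n prime_gt0.
Qed.

Lemma rat_padic_norm_ge0 x : 0 <= nrm x.
Proof.
have [->|x0] := eqVneq x 0; first by rewrite rat_padic_norm0.
by rewrite ltW // rat_padic_norm_gt0.
Qed.

Lemma rat_padic_norm_eq0 x : (nrm x == 0) = (x == 0).
Proof.
by have := rat_padic_norm_gt0 x; rewrite lt_def rat_padic_norm_ge0 andbT; do 2!case: eqP.
Qed.

Lemma rat_padic_norm1 : nrm 1 = 1.
Proof. by rewrite /rat_padic_norm /= !logn1. Qed.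

Lemma rat_padic_normN x : nrm (- x) = nrm x.
Proof. by rewrite /rat_padic_norm oppr_eq0 numqN denqN abszN. Qed.

Lemma rat_padic_normM x y : nrm (x * y) = nrm x * nrm y.
Proof.
have [->|x0] := eqVneq x 0; first by rewrite mul0r rat_padic_norm0 mul0r.
have [->|y0] := eqVneq y 0; first by rewrite mulr0 rat_padic_norm0 mulr0.
have [pp|npp] := boolP (prime p); last first.
  by rewrite !nonprime_norm ?mulf_neq0 // mulr1.
have p0 : p%:R != 0 :> rat by rewrite pnatr_eq0 -lt0n prime_gt0.
rewrite -{1}(divq_num_den x) -{1}(divq_num_den y) mulrACA -invfM -!intrM.
rewrite rat_padic_norm_frac ?mulf_neq0 ?numq_eq0 ?denq_neq0 //.
rewrite !rat_padic_normE // -expfzDr //; congr (_ ^ _).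
rewrite !abszM !lognM ?absz_gt0 ?denq_neq0 ?numq_eq0 //.
by rewrite !PoszD opprD addrACA.
Qed.

Lemma rat_padic_normD x y : nrm (x + y) <= Num.max (nrm x) (nrm y).
Proof.
have [->|x0] := eqVneq x 0; first by rewrite add0r le_max lexx orbT.
have [->|y0] := eqVneq y 0; first by rewrite addr0 le_max lexx.
have [->|xy0] := eqVneq (x + y) 0.
  by rewrite rat_padic_norm0 le_max rat_padic_norm_ge0.
have [pp|npp] := boolP (prime p); last by rewrite !nonprime_norm // maxxx.
pose a := numq x * denq y; pose b := numq y * denq x; pose c := denq x * denq y.
have Ex : x = a%:~R / c%:~R.
  by rewrite /a /c !intrM invfM mulrACA divff ?intr_eq0 ?denq_neq0 // mulr1 divq_num_den.
have Ey : y = b%:~R / c%:~R.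
  rewrite /b /c [denq x * _]mulrC !intrM invfM mulrACA.
  by rewrite divff ?intr_eq0 ?denq_neq0 // mulr1 divq_num_den.
have a0 : a != 0 by rewrite mulf_neq0 ?numq_eq0 ?denq_neq0.
have b0 : b != 0 by rewrite mulf_neq0 ?numq_eq0 ?denq_neq0.
have c0 : c != 0 by rewrite mulf_neq0 ?denq_neq0.
move: xy0; rewrite Ex Ey -mulrDl -intrD mulf_eq0 negb_or intr_eq0 => /andP[ab0 _].
rewrite !rat_padic_norm_frac //.
have p1 : 1 < p%:R :> rat by rewrite ltr1n prime_gt1.
rewrite le_max !ler_eXz2l //.
rewrite !lerD2l !lerN2 !lez_nat.
by rewrite -geq_min logn_absD_ge.
Qed.

Lemma rat_padic_normB x y : nrm (x - y) <= Num.max (nrm x) (nrm y).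
Proof. by rewrite (le_trans (rat_padic_normD _ _)) // rat_padic_normN. Qed.

Lemma rat_padic_normV x : nrm x^-1 = (nrm x)^-1.
Proof.
have [->|x0] := eqVneq x 0; first by rewrite invr0 rat_padic_norm0.
have n0 : nrm x != 0 by rewrite rat_padic_norm_eq0.
by apply: (mulfI n0); rewrite -rat_padic_normM !divff // rat_padic_norm1.
Qed.

Lemma rat_padic_norm_dist x y : nrm (x - y) < nrm x -> nrm y = nrm x.
Proof.
move=> h; apply/eqP; rewrite eq_le; apply/andP; split.
  have := rat_padic_normB x (x - y); rewrite opprB addrC subrK.
  by rewrite (max_idPl (ltW h)).
have := rat_padic_normD (x - y) y; rewrite subrK le_max.
by rewrite leNgt h.
Qed.

End RatPadicNorm.

Section CauchySequences.
Variable p : nat.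
Local Notation nrm := (rat_padic_norm p).
Implicit Types u v : nat -> rat.

Definition padic_cauchy u : Prop := forall eps : rat, 0 < eps ->
  exists N, forall m n, (N <= m)%N -> (N <= n)%N -> nrm (u m - u n) < eps.

Definition padic_null u : Prop := forall eps : rat, 0 < eps ->
  exists N, forall n, (N <= n)%N -> nrm (u n) < eps.

Definition padic_cauchy_pred : {pred nat -> rat} :=
  fun u => `[< padic_cauchy u >].

Lemma cauchy_bounded u : padic_cauchy u ->
  exists2 B : rat, 0 < B & exists N, forall n, (N <= n)%N -> nrm (u n) <= B.
Proof.
move=> /(_ 1 ltr01) [N HN]; exists (Num.max 1 (nrm (u N))).
  by rewrite lt_max ltr01.
exists N => n Nn; rewrite -(subrK (u N) (u n)).
rewrite (le_trans (rat_padic_normD _ _ _)) // ge_max !le_max lexx orbT andbT.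
by rewrite ltW ?HN.
Qed.

Lemma padic_cauchy_subring : subring_closed padic_cauchy_pred.
Proof.
split=> [|u v /asboolP hu /asboolP hv|u v /asboolP hu /asboolP hv]; apply/asboolP.
- by move=> e e0; exists 0%N => m n _ _; rewrite subrr rat_padic_norm0.
- move=> e e0; have [N1 H1] := hu e e0; have [N2 H2] := hv e e0.
  exists (maxn N1 N2) => m n; rewrite !geq_max => /andP[m1 m2] /andP[n1 n2].
  rewrite opprD addrACA -opprD.
  by rewrite (le_lt_trans (rat_padic_normB _ _ _)) // gt_max H1 //= H2.
- move=> e e0.
  have [B1 B10 [N1 H1]] := cauchy_bounded hu.
  have [B2 B20 [N2 H2]] := cauchy_bounded hv.
  have [N3 H3] := hu _ (divr_gt0 e0 B20).
  have [N4 H4] := hv _ (divr_gt0 e0 B10).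
  exists (maxn (maxn N1 N2) (maxn N3 N4)) => m n.
  rewrite !geq_max => /andP[/andP[m1 m2] /andP[m3 m4]].
  move=> /andP[/andP[n1 n2] /andP[n3 n4]].
  have -> : (u * v) m - (u * v) n = (u m - u n) * v m + u n * (v m - v n).
    by rewrite mulrBl mulrBr addrA subrK.
  rewrite (le_lt_trans (rat_padic_normD _ _ _)) // gt_max !rat_padic_normM.
  apply/andP; split.
    rewrite (le_lt_trans (ler_wpM2l (rat_padic_norm_ge0 _ _) (H2 _ m2))) //.
    by rewrite -ltr_pdivlMr // H3.
  rewrite (le_lt_trans (ler_wpM2r (rat_padic_norm_ge0 _ _) (H1 _ n1))) //.
  by rewrite mulrC -ltr_pdivlMr // H4.
Qed.

HB.instance Definition _ := GRing.isSubringClosed.Build (nat -> rat)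
  padic_cauchy_pred padic_cauchy_subring.

Record padic_cauchy_seq := PadicCauchySeq {
  padic_seq :> nat -> rat;
  _ : padic_seq \in padic_cauchy_pred
}.

HB.instance Definition _ := [isSub for padic_seq].
HB.instance Definition _ := [Choice of padic_cauchy_seq by <:].
HB.instance Definition _ :=
  [SubChoice_isSubComNzRing of padic_cauchy_seq by <:].

Lemma padic_seqP (u : padic_cauchy_seq) : padic_cauchy u.
Proof. exact/asboolP/(valP u). Qed.

Definition padic_null_pred : {pred padic_cauchy_seq} :=
  fun u : padic_cauchy_seq => `[< padic_null u >].

Lemma padic_null_ideal : idealr_closed padic_null_pred.
Proof.
split.
- by apply/asboolP => e e0; exists 0%N => n _; rewrite rat_padic_norm0.
- apply/asboolP => /(_ 1 ltr01) [N /(_ N (leqnn _))].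
  by rewrite rat_padic_norm1 ltxx.
- move=> a u v /asboolP hu /asboolP hv; apply/asboolP => e e0.
  have [B B0 [N1 H1]] := cauchy_bounded (padic_seqP a).
  have [N2 H2] := hu _ (divr_gt0 e0 B0).
  have [N3 H3] := hv _ e0.
  exists (maxn N1 (maxn N2 N3)) => n; rewrite !geq_max => /and3P[n1 n2 n3].
  rewrite (le_lt_trans (rat_padic_normD _ _ _)) // gt_max rat_padic_normM H3 //.
  rewrite andbT (le_lt_trans (ler_wpM2r (rat_padic_norm_ge0 _ _) (H1 _ n1))) //.
  by rewrite mulrC -ltr_pdivlMr // H2.
Qed.

HB.instance Definition _ :=
  isIdealr.Build padic_cauchy_seq padic_null_pred padic_null_ideal.

(* Cauchy sequences of rationals modulo null sequences, i.e. the completion of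
   the rationals for the p-adic norm. *)
Definition padic : Type := {ideal_quot padic_null_pred}.

HB.instance Definition _ := GRing.ComNzRing.on padic.

Lemma nonnull_away (u : padic_cauchy_seq) : u \notin padic_null_pred ->
  exists2 c : rat, 0 < c & exists N, forall n, (N <= n)%N -> nrm (u n) = c.
Proof.
move=> /asboolPn; rewrite /padic_null => /existsNP[e] /not_implyP[e0] /forallNP h.
have [N HN] := padic_seqP u e0.
have /existsNP[m /not_implyP[Nm /negP]] := h N; rewrite -leNgt => em.
exists (nrm (u m)); first exact: lt_le_trans em.
by exists N => n Nn; apply: rat_padic_norm_dist; apply: lt_le_trans em; apply: HN.
Qed.

Definition padic_class (u : padic_cauchy_seq) : padic :=
  \pi_({ideal_quot padic_null_pred}) u.

Lemma padic_classP (x : padic) : padic_class (repr x) = x.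
Proof. exact: reprK. Qed.

Lemma padic_class_eq (u v : padic_cauchy_seq) :
  (padic_class u == padic_class v) = (u - v \in padic_null_pred).
Proof. by rewrite Quotient.idealrBE. Qed.

Lemma padic_class_is_zmod_morphism : zmod_morphism padic_class.
Proof. by move=> u v; rewrite /padic_class rmorphB. Qed.

HB.instance Definition _ := GRing.isZmodMorphism.Build padic_cauchy_seq padic
  padic_class padic_class_is_zmod_morphism.

Lemma padic_class_is_monoid_morphism : monoid_morphism padic_class.
Proof.
by split=> [|u v]; rewrite /padic_class ?rmorph1 ?rmorphM.
Qed.

HB.instance Definition _ := GRing.isMonoidMorphism.Build padic_cauchy_seq padic
  padic_class padic_class_is_monoid_morphism.

Lemma padic_class_eq0 (u : padic_cauchy_seq) :
  (padic_class u == 0) = (u \in padic_null_pred).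
Proof. by rewrite -[0](rmorph0 padic_class) padic_class_eq subr0. Qed.

Lemma padic_has_inv (x : padic) : x != 0 -> exists y : padic, y * x = 1.
Proof.
rewrite -[x]padic_classP padic_class_eq0; set u := repr x => u0.
have [c c0 [N HN]] := nonnull_away u0.
have un0 n : (N <= n)%N -> u n != 0.
  by move=> Nn; rewrite -(rat_padic_norm_eq0 p) HN // gt_eqF.
have cw : (fun n => (u n)^-1) \in padic_cauchy_pred.
  apply/asboolP => e e0.
  have [K HK] := padic_seqP u (mulr_gt0 e0 (mulr_gt0 c0 c0)).
  exists (maxn N K) => m n; rewrite !geq_max => /andP[m1 m2] /andP[n1 n2].
  have -> : (u m)^-1 - (u n)^-1 = (u n - u m) / (u m * u n).
    rewrite -(mulrC (u n)) mulrBl invfM mulrA divff ?un0 // mul1r.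
    by rewrite mulrCA divff ?un0 // mulr1.
  rewrite rat_padic_normM rat_padic_normV rat_padic_normM !HN //.
  by rewrite ltr_pdivrMr ?mulr_gt0 // HK.
exists (padic_class (PadicCauchySeq cw)).
rewrite -rmorphM -(rmorph1 padic_class).
apply/eqP; rewrite padic_class_eq; apply/asboolP => e e0.
exists N => n Nn.
have -> : padic_seq (PadicCauchySeq cw * u - 1) n = (u n)^-1 * u n - 1 by [].
by rewrite mulVf ?un0 // subrr rat_padic_norm0.
Qed.

Definition padic_inv (x : padic) : padic :=
  xget 0 [set y : padic | y * x = 1]%classic.

Lemma padic_mulVf (x : padic) : x != 0 -> padic_inv x * x = 1.
Proof.
move=> /padic_has_inv[y yx]; rewrite /padic_inv; case: xgetP => [z -> //|].
by move=> /(_ y).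
Qed.

Lemma padic_inv0 : padic_inv 0 = 0.
Proof.
rewrite /padic_inv; case: xgetP => [z _ /= /eqP|//].
by rewrite mulr0 eq_sym oner_eq0.
Qed.

HB.instance Definition _ :=
  GRing.ComNzRing_isField.Build padic padic_mulVf padic_inv0.

Definition rat_seq_lim (a : nat -> rat) (l : rat) : Prop :=
  forall eps : rat, 0 < eps ->
  exists N, forall n, (N <= n)%N -> `|a n - l| < eps.

(* The norm of the class of u is the limit of the norms of the u n; this limit
   always exists in rat and does not depend on u (padic_norm_class). *)
Definition padic_norm (x : padic) : rat :=
  xget 0 [set l | rat_seq_lim (fun n => nrm (repr x n)) l]%classic.

Lemma rat_seq_lim_unique a l l' :
  rat_seq_lim a l -> rat_seq_lim a l' -> l = l'.
Proof.
move=> h h'; apply/eqP; rewrite -subr_eq0 -normr_eq0; apply/negPn/negP => d0.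
have e0 : 0 < `|l - l'| / 2 by rewrite divr_gt0 // lt_def d0 normr_ge0.
have [N H] := h _ e0; have [N' H'] := h' _ e0.
have {}H := H (maxn N N') (leq_maxl _ _).
have {}H' := H' (maxn N N') (leq_maxr _ _).
have := ltrD H H'; rewrite -splitr; apply/negP; rewrite -leNgt.
by rewrite [X in _ <= X + _]distrC (le_trans _ (ler_normD _ _)) // addrA subrK.
Qed.

Lemma norm_lim_ex (u : padic_cauchy_seq) :
  (u \in padic_null_pred /\ rat_seq_lim (fun n => nrm (u n)) 0) \/
  (exists c, [/\ 0 < c, u \notin padic_null_pred,
     rat_seq_lim (fun n => nrm (u n)) c &
     exists N, forall n, (N <= n)%N -> nrm (u n) = c]).
Proof.
have [u0|u0] := boolP (u \in padic_null_pred).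
  left; split=> // e e0; move/asboolP: u0 => /(_ e e0)[N HN]; exists N => n Nn.
  by rewrite subr0 ger0_norm ?rat_padic_norm_ge0 ?HN.
right; have [c c0 [N HN]] := nonnull_away u0; exists c; split=> //.
- by move=> e e0; exists N => n Nn; rewrite HN // subrr normr0.
- by exists N.
Qed.

Lemma padic_norm_class (u : padic_cauchy_seq) :
  rat_seq_lim (fun n => nrm (u n)) (padic_norm (padic_class u)).
Proof.
set x := padic_class u; set w := repr x.
have wu : w - u \in padic_null_pred.
  by rewrite -padic_class_eq padic_classP.
have uw : (u \in padic_null_pred) = (w \in padic_null_pred).
  by rewrite -!padic_class_eq0 -/x padic_classP.
have key l : rat_seq_lim (fun n => nrm (w n)) l ->
             rat_seq_lim (fun n => nrm (u n)) l.
  case: (norm_lim_ex w) => [[w0 hw0]|[c [c0 w0 hwc [N HN]]]] hl.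
    rewrite (rat_seq_lim_unique hl hw0).
    case: (norm_lim_ex u) => [[]|[d [_]]]; first by [].
    by rewrite uw w0.
  rewrite (rat_seq_lim_unique hl hwc) => e e0.
  move/asboolP: wu => /(_ c c0)[K HK]; exists (maxn N K) => n.
  rewrite geq_max => /andP[n1 n2].
  rewrite (@rat_padic_norm_dist p (w n)); first by rewrite HN // subrr normr0.
  by rewrite (HN n) //; exact: HK.
apply: key; rewrite /padic_norm; case: xgetP => [l _ //|/=] h.
case: (norm_lim_ex w) => [[_ /h//]|[c [_ _ /h]]]; by [].
Qed.

Lemma padic_norm_classE (u : padic_cauchy_seq) l :
  rat_seq_lim (fun n => nrm (u n)) l -> padic_norm (padic_class u) = l.
Proof. by move=> h; apply: rat_seq_lim_unique (padic_norm_class u) h. Qed.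

Lemma padic_norm_ev (u : padic_cauchy_seq) : padic_class u != 0 ->
  exists N, forall n, (N <= n)%N -> nrm (u n) = padic_norm (padic_class u).
Proof.
rewrite padic_class_eq0; case: (norm_lim_ex u) => [[->//]|[c [_ _ h [N HN]]]] _.
by exists N => n /HN ->; rewrite (padic_norm_classE h).
Qed.

Lemma padic_norm0 : padic_norm 0 = 0.
Proof.
rewrite -(rmorph0 padic_class); apply: padic_norm_classE => e e0.
by exists 0%N => n _; rewrite rat_padic_norm0 subrr normr0.
Qed.

Lemma padic_norm_gt0 (x : padic) : (0 < padic_norm x) = (x != 0).
Proof.
have [->|] := eqVneq x 0; first by rewrite padic_norm0 ltxx.
rewrite -[x]padic_classP padic_class_eq0.
by case: (norm_lim_ex (repr x)) => [[->//]|[c [c0 _ /padic_norm_classE ->]]].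
Qed.

Lemma padic_norm_ge0 (x : padic) : 0 <= padic_norm x.
Proof.
have [->|x0] := eqVneq x 0; first by rewrite padic_norm0.
by rewrite ltW // padic_norm_gt0.
Qed.

Lemma padic_norm_eq0 (x : padic) : (padic_norm x == 0) = (x == 0).
Proof.
have := padic_norm_gt0 x; rewrite lt_def padic_norm_ge0 andbT.
by do 2!case: eqP.
Qed.

Lemma padic_normM (x y : padic) :
  padic_norm (x * y) = padic_norm x * padic_norm y.
Proof.
have [->|] := eqVneq x 0; first by rewrite mul0r padic_norm0 mul0r.
have [->|] := eqVneq y 0; first by rewrite mulr0 padic_norm0 mulr0.
rewrite -[x]padic_classP -[y]padic_classP.
move: (repr x) (repr y) => u v v0 u0; rewrite -rmorphM.
have [N1 H1] := padic_norm_ev u0; have [N2 H2] := padic_norm_ev v0.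
apply: padic_norm_classE => e e0; exists (maxn N1 N2) => n.
rewrite geq_max => /andP[n1 n2].
have -> : padic_seq (u * v) n = u n * v n by [].
by rewrite rat_padic_normM H1 // H2 // subrr normr0.
Qed.

Lemma padic_normD (x y : padic) :
  padic_norm (x + y) <= Num.max (padic_norm x) (padic_norm y).
Proof.
have [->|] := eqVneq x 0; first by rewrite add0r le_max lexx orbT.
have [->|] := eqVneq y 0; first by rewrite addr0 le_max lexx.
have [->|] := eqVneq (x + y) 0.
  by rewrite padic_norm0 le_max padic_norm_ge0.
rewrite -[x]padic_classP -[y]padic_classP.
move: (repr x) (repr y) => u v; rewrite -rmorphD => uv0 v0 u0.
have [N1 H1] := padic_norm_ev u0; have [N2 H2] := padic_norm_ev v0.
have [N3 H3] := padic_norm_ev uv0.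
pose n := maxn N1 (maxn N2 N3).
have /and3P[n1 n2 n3] : [&& N1 <= n, N2 <= n & N3 <= n]%N.
  by rewrite -!geq_max.
by rewrite -(H1 n) // -(H2 n) // -(H3 n) //; apply: rat_padic_normD.
Qed.

Lemma padic_norm_rat (x : rat) (cx : (fun=> x) \in padic_cauchy_pred) :
  padic_norm (padic_class (PadicCauchySeq cx)) = nrm x.
Proof.
by apply: padic_norm_classE => e e0; exists 0%N => n _; rewrite subrr normr0.
Qed.

Definition padic_int : {pred padic} := fun x => padic_norm x <= 1.

End CauchySequences.

Section Iwasawa.
Variables (p n : nat).
Implicit Types M N A K : 'M[padic p]_n.

Definition in_SL M : Prop := \det M = 1.

Definition unit_upper_triangular N : Prop :=
  (forall i j : 'I_n, (j < i)%N -> N i j = 0) /\ (forall i, N i i = 1).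

Definition iwasawa_decomposition M N A K : Prop :=
  [/\ M = N *m A *m K,
      in_SL N /\ unit_upper_triangular N,
      in_SL A /\ is_diag_mx A
    & in_SL K /\ K \is a mxOver (@padic_int p)].

(* The sequence y_1, ..., y_(n-1) is the restriction of a function on nat, read
   with the conventions y_0 = y_n = 1; the other values of y are irrelevant. *)
Definition iwasawa_diag (y : nat -> padic p) : 'M[padic p]_n :=
  let y' (i : nat) := if (0 < i < n)%N then y i else 1 in
  diag_mx (\row_(i < n) (y' i.+1 / y' i)).

End Iwasawa.

Definition minor (R : comPzRingType) (n k : nat) (M : 'M[R]_n)
    (r c : 'I_k -> 'I_n) : R :=
  \det (\matrix_(i < k, j < k) M (r i) (c j)).

Definition last_rows (n k : nat) (le_kn : (k <= n)%N) (i : 'I_k) : 'I_n :=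
  cast_ord (subnK le_kn) (rshift (n - k) i).

Definition Theta (k n : nat) : {set {ffun 'I_k -> 'I_n}} :=
  [set s : {ffun 'I_k -> 'I_n} |
    [forall i : 'I_k, forall j : 'I_k, (i < j)%N ==> (s i < s j)%N]].

(* Main.v *)
From HB Require Import structures.
Require Import Defs.
From mathcomp Require Import all_boot all_order all_algebra perm.

Import Order.TTheory GRing.Theory Num.Theory.

Local Open Scope ring_scope.

(** The last [k] rows of [N] vanish outside the last [k] columns, so the last
    [k] rows of [M = N A K] are obtained from those of [K] by multiplying on
    the left by the lower right [k x k] blocks of [N] and [A].  These blocks
    have determinants [1] and, by telescoping, [1 / y_(n-k)].  Hence each minor
    of [M] in question is [1 / y_(n-k)] times the corresponding minor of [K],
    and it remains to see that the latter have maximal norm [1].  They are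
    integral; and since [K] times its integral adjugate is the identity,
    multilinearity (the easy half of Cauchy-Binet) writes [1] as an integral
    combination of them, so by the ultrametric inequality they cannot all have
    norm less than [1]. *)

Section PadicIntegers.
Variable p : nat.
Implicit Types x y : padic p.

Lemma padic_norm1 : padic_norm (1 : padic p) = 1.
Proof.
have n0 : padic_norm (1 : padic p) != 0 by rewrite padic_norm_eq0 oner_neq0.
by apply: (mulfI n0); rewrite -padic_normM !mulr1.
Qed.

Lemma padic_normN x : padic_norm (- x) = padic_norm x.
Proof.
(* Norms are nonnegative, so comparing squares suffices. *)
apply/eqP; rewrite -(@eqrXn2 _ 2) ?padic_norm_ge0 //.
by rewrite !expr2 -!padic_normM mulrNN.
Qed.

Lemma padic_normV x : padic_norm x^-1 = (padic_norm x)^-1.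
Proof.
have [->|x0] := eqVneq x 0; first by rewrite invr0 padic_norm0 invr0.
have n0 : padic_norm x != 0 by rewrite padic_norm_eq0.
by apply: (mulfI n0); rewrite -padic_normM !divff // padic_norm1.
Qed.

Lemma padic_norm_sign (b : bool) x : padic_norm ((-1) ^+ b * x) = padic_norm x.
Proof. by case: b; rewrite ?mulN1r ?padic_normN // mul1r. Qed.

(** The ultrametric inequality preserves strict bounds; [0 < e] covers the empty sum. *)
Lemma padic_norm_sum_lt (I : finType) (F : I -> padic p) (e : rat) :
  0 < e -> (forall i, padic_norm (F i) < e) -> padic_norm (\sum_i F i) < e.
Proof.
move=> e0 Fe; elim/big_ind: _ => [|x y xe ye|i _]; first by rewrite padic_norm0.
  by rewrite (le_lt_trans (padic_normD _ _)) // gt_max xe.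
exact: Fe.
Qed.

Lemma padic_int_subring : subring_closed (@padic_int p).
Proof.
split=> [|x y|x y]; rewrite !unfold_in; first by rewrite padic_norm1.
  move=> x1 y1; rewrite (le_trans (padic_normD _ _)) //.
  by rewrite padic_normN ge_max x1.
by move=> x1 y1; rewrite padic_normM mulr_ile1 ?padic_norm_ge0.
Qed.

HB.instance Definition _ :=
  GRing.isSubringClosed.Build (padic p) (@padic_int p) padic_int_subring.

End PadicIntegers.

Section Determinants.

Lemma rpred_det (R : comNzRingType) (S : subringClosed R) n (A : 'M[R]_n) :
  A \is a mxOver S -> \det A \in S.
Proof.
move=> /mxOverP AS; apply: rpred_sum => s _.
by rewrite rpredM ?rpred_sign ?rpred_prod.
Qed.

Lemma mxOver_adj (R : comNzRingType) (S : subringClosed R) n (A : 'M[R]_n) :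
  A \is a mxOver S -> \adj A \is a mxOver S.
Proof.
move=> /mxOverP AS; apply/mxOverP => i j; rewrite mxE rpredM ?rpred_sign //.
by apply: rpred_det; apply/mxOverP => ? ?; rewrite !mxE.
Qed.

Lemma minorE (R : comPzRingType) n k (M : 'M[R]_n) (r c : 'I_k -> 'I_n) :
  minor M r c = \det (mxsub r c M).
Proof. by congr (\det _); apply/matrixP => i j; rewrite !mxE. Qed.

(** Multilinearity: column [j] of [B *m C] is a combination of the columns of [B], and [f j] is the
    one picked in its expansion. All [f] are kept, injective or not, since only a bound on each term
    is wanted. *)
Lemma det_mulmx_colsub (R : comPzRingType) k n
    (B : 'M[R]_(k, n)) (C : 'M[R]_(n, k)) :
  \det (B *m C) =
  \sum_(f : {ffun 'I_k -> 'I_n}) \det (colsub f B) * \prod_j C (f j) j.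
Proof.
rewrite -det_tr trmx_mul.
transitivity (\sum_(f : {ffun 'I_k -> 'I_n}) \sum_(s : 'S_k)
    (-1) ^+ s * \prod_i (C (f i) i * B (s i) (f i))).
  rewrite exchange_big; apply: eq_bigr => /= s _; rewrite -big_distrr /=.
  rewrite -(bigA_distr_bigA (fun i j => C j i * B (s i) j)) /=.
  congr (_ * _); apply: eq_bigr => i _.
  by rewrite !mxE; apply: eq_bigr => j _; rewrite !mxE.
apply: eq_bigr => f _; rewrite -det_tr big_distrl /=; apply: eq_bigr => s _.
rewrite -mulrA big_split /= [X in _ * X]mulrC; congr (_ * (_ * _)).
by apply: eq_bigr => i _; rewrite !mxE.
Qed.

(** [s] lists the values of [f] in sorted order and [q] sends an index to its rank; injectivity
    makes the order strict. *)
Lemma Theta_perm k n (f : {ffun 'I_k -> 'I_n}) : injective f ->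
  exists2 s, s \in Theta k n & exists q : 'S_k, f =1 s \o q.
Proof.
move=> f_inj; pose le_val (i j : 'I_n) := (i <= j)%N.
pose t := [tuple f i | i < k]; pose u := sort_tuple le_val t.
have /tuple_permP[q tq] : perm_eq t u by rewrite perm_sym perm_sort.
exists [ffun i => tnth u i]; last first.
  exists q => i; rewrite /= ffunE -[f i](tnth_mktuple f).
  by rewrite -/t (val_inj tq : t = _) tnth_mktuple.
have u_sorted : sorted ltn (map val u).
  rewrite ltn_sorted_uniq_leq map_inj_uniq; last exact: val_inj.
  rewrite sort_uniq map_inj_uniq ?enum_uniq //= sorted_map.
  by apply: sort_sorted => i j; apply: leq_total.
rewrite inE; apply/'forall_forallP => i j; apply/implyP => ij; rewrite !ffunE.
have szu : size u = k by rewrite size_tuple.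
have := sorted_ltn_nth ltn_trans 0%N u_sorted.
move=> /(_ i j); rewrite !inE size_map szu !ltn_ord => /(_ isT isT ij).
by rewrite !(nth_map (tnth t i)) ?szu ?ltn_ord // -!tnth_nth.
Qed.

End Determinants.

Section MinorsOfIntegralMatrices.
Variables (p n k : nat) (K : 'M[padic p]_n) (r : 'I_k -> 'I_n).
Hypothesis K_int : K \is a mxOver (@padic_int p).

Lemma padic_norm_minor_le1 (c : 'I_k -> 'I_n) : padic_norm (minor K r c) <= 1.
Proof.
suff : minor K r c \in @padic_int p by [].
apply: rpred_det; apply/mxOverP => i j; rewrite mxE.
by move/mxOverP: K_int; apply.
Qed.

(** Permuting columns changes a minor only by a sign, which has norm 1. *)
Lemma padic_norm_minor_perm (c : 'I_k -> 'I_n) (s : {ffun 'I_k -> 'I_n})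
    (q : 'S_k) :
  c =1 s \o q -> padic_norm (minor K r c) = padic_norm (minor K r s).
Proof.
move=> cs; rewrite !minorE.
have -> : mxsub r c K = col_perm q (mxsub r s K).
  by apply/matrixP => i j; rewrite !mxE cs.
by rewrite col_permE det_mulmx det_perm mulrC padic_norm_sign.
Qed.

Lemma exists_minor_norm1 : injective r -> in_SL K ->
  exists2 s, s \in Theta k n & padic_norm (minor K r s) = 1.
Proof.
move=> r_inj detK.
have [/existsP[s /andP[sT /eqP]]|/existsPn no_s] :=
  boolP [exists s, (s \in Theta k n) && (padic_norm (minor K r s) == 1)].
  by exists s.
have Theta_lt1 s : s \in Theta k n -> padic_norm (minor K r s) < 1.
  by move=> sT; have := no_s s; rewrite sT lt_neqAle padic_norm_minor_le1 => ->.
(* From increasing [f] to all [f]: an injective one can be sorted, and a repeated column makes the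
   minor zero. *)
have minor_lt1 (f : {ffun 'I_k -> 'I_n}) : padic_norm (minor K r f) < 1.
  have [/injectiveP f_inj|/injectivePn[i [j ij fij]]] := boolP (injectiveb f).
    by have [s sT [q fs]] := Theta_perm _ _ _ f_inj;
       rewrite (padic_norm_minor_perm _ _ _ fs) Theta_lt1.
  rewrite minorE -det_tr (determinant_alternate ij) ?padic_norm0 // => l.
  by rewrite !mxE fij.
(* The product is the block of [K *m \adj K = 1] on rows and columns [r], an identity matrix because
   [r] is injective. *)
have : \det (rowsub r K *m colsub r (\adj K)) = 1.
  rewrite -mxsub_mul mul_mx_adj detK -[RHS](det1 _ k); congr (\det _).
  by apply/matrixP => i j; rewrite !mxE (inj_eq r_inj).
rewrite det_mulmx_colsub => det_eq1.
suff : padic_norm (1 : padic p) < 1 by rewrite padic_norm1 ltxx.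
rewrite -[X in padic_norm X]det_eq1; apply: padic_norm_sum_lt => // f.
(* Each term is a minor of norm below 1 times an integral coefficient. *)
rewrite padic_normM -mxsubcr -minorE.
rewrite (le_lt_trans _ (minor_lt1 f)) // ler_piMr ?padic_norm_ge0 //.
suff : \prod_j colsub r (\adj K) (f j) j \in @padic_int p by [].
apply: rpred_prod => j _; rewrite mxE.
by have /mxOverP := mxOver_adj _ _ _ _ K_int; apply.
Qed.

End MinorsOfIntegralMatrices.

Section LastRows.
Variables (n k : nat) (le_kn : (k <= n)%N).
Local Notation last := (last_rows le_kn).

Lemma last_rows_inj : injective last.
Proof. by move=> i j /cast_ord_inj/rshift_inj. Qed.

Lemma last_rowsP (j : 'I_n) : (n - k <= j)%N -> exists i, j = last i.
Proof.
move=> kj; have lt_jk : (j - (n - k) < k)%N by rewrite ltn_subLR // subnK.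
by exists (Ordinal lt_jk); apply: val_inj; rewrite /= subnKC.
Qed.

Lemma minor_last_rows (R : comPzRingType) (N A K : 'M[R]_n) (c : 'I_k -> 'I_n) :
  (forall i j : 'I_n, (j < i)%N -> N i j = 0) -> is_diag_mx A ->
  minor (N *m A *m K) last c =
  (\prod_i N (last i) (last i)) * (\prod_i A (last i) (last i)) *
  minor K last c.
Proof.
move=> N_trig /is_diag_mxP A_diag.
have NA0 i (j : 'I_n) : (j < n - k)%N -> (N *m A) (last i) j = 0.
  move=> jk; rewrite mxE big1 // => l _.
  have [->|lj] := eqVneq l j; last by rewrite A_diag ?mulr0.
  by rewrite N_trig ?mul0r //= (leq_trans jk) // leq_addr.
have -> : minor (N *m A *m K) last c =
    \det (mxsub last last (N *m A) *m mxsub last c K).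
  (* By [NA0], only indices in the image of [last] contribute to the entries on the left. *)
  congr (\det _); apply/matrixP => i j; rewrite !mxE.
  under [RHS]eq_bigr => l _ do rewrite [mxsub last c K _ _]mxE [mxsub _ _ _ _ _]mxE.
  rewrite -(big_imset (h := last) (A := predT)
    (fun l => (N *m A) (last i) l * K l (c j))) /=; last first.
    by move=> ? ? _ _; apply: last_rows_inj.
  rewrite [RHS]big_rmcond // => l; apply: contraNeq => NAK0.
  have /last_rowsP[l' ->] : (n - k <= l)%N.
    by rewrite leqNgt; apply: contra NAK0 => /NA0 ->; rewrite mul0r.
  exact: imset_f.
rewrite det_mulmx -minorE; congr (_ * _).
have NAlast i j :
    (N *m A) (last i) (last j) = N (last i) (last j) * A (last j) (last j).
  rewrite mxE (bigD1 (last j)) //= big1 ?addr0 // => l lj.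
  by rewrite A_diag ?mulr0.
(* [det_trig] expects a lower triangular matrix, hence the transpose. *)
rewrite -det_tr det_trig; last first.
  apply/is_trig_mxP => i j ij; rewrite 2!mxE NAlast.
  by rewrite N_trig ?mul0r //= ltn_add2l.
by rewrite -big_split; apply: eq_bigr => i _; rewrite 2!mxE NAlast.
Qed.

End LastRows.

(* The condition [in_SL] is what makes the [y_i] nonzero, as telescoping needs. *)
Lemma prod_iwasawa_diag p n k (le_kn : (k <= n)%N) (y : nat -> padic p) :
  (0 < k < n)%N -> in_SL (iwasawa_diag n y) ->
  \prod_i iwasawa_diag n y (last_rows le_kn i) (last_rows le_kn i) =
  (y (n - k)%N)^-1.
Proof.
move=> /andP[k_gt0 k_ltn]; rewrite /in_SL /iwasawa_diag det_diag => prod_eq1.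
pose z (i : nat) := if (0 < i < n)%N then y i else 1.
have z_neq0 i : (i < n)%N -> z i != 0.
  move=> i_ltn; apply: contra_eq_neq prod_eq1 => zi0.
  (* As [0^-1 = 0], a zero [z i] would make the diagonal entry [z i.+1 / z i], and so the
     determinant, vanish. *)
  rewrite (bigD1 (Ordinal i_ltn)) //= mxE /= -/(z i) zi0 invr0 mulr0 mul0r.
  by rewrite eq_sym oner_neq0.
rewrite (eq_bigr (fun i : 'I_k => z (i + (n - k)).+1 / z (i + (n - k))%N)).
  rewrite -(big_mkord xpredT (fun i => z (i + (n - k)).+1 / z (i + (n - k))%N)).
  have := big_addn 0 n (n - k) xpredT (fun i => z i.+1 / z i).
  rewrite add0n subKn // => <-.
  (* What remains is [z n / z (n - k)], where [z n = 1] by convention and [0 < n - k < n]. *)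
  rewrite telescope_prodf ?ltn_subrL ?k_gt0 ?(ltn_trans k_gt0) //.
    by rewrite /z ltnn andbF subn_gt0 k_ltn ltn_subrL k_gt0 (ltn_trans k_gt0) ?div1r.
  by move=> i /andP[_]; apply: z_neq0.
by move=> i _; rewrite !mxE eqxx mulr1n /= addnC.
Qed.

(* The maximum is over nonnegative rationals and a nonempty index set, so the
   base value 0 does not affect it. *)
Theorem mainTheorem7 (p n : nat) (p_prime : prime p)
    (M N A K : 'M[padic p]_n) (y : nat -> padic p)
    (M_SL : in_SL M)
    (MNAK : iwasawa_decomposition M N A K)
    (A_diag : A = iwasawa_diag n y)
    (k : nat) (k_gt0 : (0 < k)%N) (k_ltn : (k < n)%N) :
  padic_norm (y (n - k)%N) =
  (\big[Num.max/0]_(s in Theta k n)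
     padic_norm (minor M (last_rows (ltnW k_ltn)) s))^-1.
Proof.
case: MNAK => -> [_ [N_trig N1]] [A_SL A_diagonal] [K_SL K_int].
have minorM (s : 'I_k -> 'I_n) :
    padic_norm (minor (N *m A *m K) (last_rows (ltnW k_ltn)) s) =
    (padic_norm (y (n - k)%N))^-1 *
    padic_norm (minor K (last_rows (ltnW k_ltn)) s).
  rewrite minor_last_rows // big1 ?mul1r; last by move=> i _; apply: N1.
  rewrite A_diag prod_iwasawa_diag ?k_gt0 // -?A_diag //.
  by rewrite padic_normM padic_normV.
(* A minor of [K] of norm 1 bounds the maximum from below; integrality of all minors of [K] bounds
   it from above. *)
apply: invr_inj; rewrite invrK; apply/eqP; rewrite eq_le; apply/andP; split.
  have [s sT s1] :=
    exists_minor_norm1 _ _ _ _ _ K_int (last_rows_inj _ _ (ltnW k_ltn)) K_SL.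
  apply: le_trans (le_bigmax_cond _ _ sT).
  by rewrite minorM s1 mulr1.
apply: bigmax_le => [|s _]; first by rewrite invr_ge0 padic_norm_ge0.
by rewrite minorM ler_piMr ?invr_ge0 ?padic_norm_ge0 ?padic_norm_minor_le1.
Qed.
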